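(* For a Ferrers board $B=B(b_1,\dots,b_n)$ with $0\le b_1\le\cdots\le b_n\le n$, \[ \prod_{i=1}^n [z+b_i]_{aq^{-2b_i},\,bq^{-b_i};q,p}=\sum_{k=0}^n f_{n-k}(a,b;q,p;B)\,\bigl([z]_{a,b;q,p}\bigr)^k. \]
   Context: $|p|<1$, $q,a,b,z$ generic complex parameters (with $q^{z+m}:=q^zq^m$). $\theta(x;p)=\prod_{j\ge0}(1-p^jx)(1-p^{j+1}/x)$, $\theta(x_1,\dots,x_m;p)=\prod_i\theta(x_i;p)$. For parameters $A,B$: $[z]_{A,B;q,p}=\frac{\theta(q^z,Aq^z,Bq^2,A/B;p)}{\theta(q,Aq,Bq^{z+1},Aq^{z-1}/B;p)}$, and $w_{a,b;q,p}(k)=\frac{\theta(aq^{2k+1},bq^k,aq^{k-2}/b;p)}{\theta(aq^{2k-1},bq^{k+2},aq^k/b;p)}\,q$. $B(b_1,\dots,b_n)$ is the set of cells $(i,j)$ with $1\le i\le n$, $1\le j\le b_i$ (column $i$, row $j$). A file placement of $k$ rooks is a $k$-subset $Q\subseteq B$ with no two cells in the same column; $\mathcal{F}_k(B)$ is the set of these; a rook cancels all cells below it in its column, and $U_B(Q)$ is the set of cells of $B\setminus Q$ not cancelled by $Q$. The elliptic file numbers are $f_k(a,b;q,p;B)=\sum_{Q\in\mathcal{F}_k(B)}\prod_{(i,j)\in U_B(Q)}w_{a,b;q,p}(1-j)$. *)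

(* Defs.v *)
From HB Require Import structures.
From mathcomp Require Import all_boot all_order all_algebra.
From mathcomp Require Import complex.
From mathcomp Require Import all_classical all_reals all_analysis.

Set Implicit Arguments.
Unset Strict Implicit.
Unset Printing Implicit Defensive.

Import Order.TTheory GRing.Theory Num.Theory.
Import numFieldNormedType.Exports.

Local Open Scope ring_scope.
Local Open Scope complex_scope.

Section Elliptic.
Variable R : realType.
Local Notation C := R[i].

(* The complex exponential; the library only provides the real one. *)
Definition cexp (z : C) : C :=
  (expR (complex.Re z) * cos (complex.Im z))
    +i* (expR (complex.Re z) * sin (complex.Im z)).

(* [q^z] for the determination [l] of [log q], that is for [cexp l = q]; then
   [cpow l (z + m%:~R) = cpow l z * q ^ m] for every integer [m]. *)
Definition cpow (l z : C) : C := cexp (z * l).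

(* The topology on the complex numbers is the one given by the modulus, which
   the library attaches to any [numFieldType]. *)
Definition theta (p x : C) : C :=
  limn (fun N : nat =>
    (\prod_(0 <= j < N) ((1 - p ^+ j * x) * (1 - p ^+ j.+1 / x)))
      : (C : numFieldType)).

Definition thetas (p : C) (s : seq C) : C := \prod_(x <- s) theta p x.

(* The elliptic number [z]_{A,B;q,p}, with q = cexp l. *)
Definition ellnum_den (l p A B z : C) : C :=
  let q := cexp l in
  thetas p [:: q; A * q; B * cpow l (z + 1); A * cpow l (z - 1) / B].

Definition ellnum (l p A B z : C) : C :=
  let q := cexp l in
  thetas p [:: cpow l z; A * cpow l z; B * q ^+ 2; A / B]
    / ellnum_den l p A B z.

(* The weight w_{a,b;q,p}(k), for an integer k. *)
Definition ellweight_den (a b q p : C) (k : int) : C :=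
  thetas p [:: a * q ^ (2 * k - 1); b * q ^ (k + 2); a * q ^ k / b].

Definition ellweight (a b q p : C) (k : int) : C :=
  thetas p [:: a * q ^ (2 * k + 1); b * q ^ k; a * q ^ (k - 2) / b]
    / ellweight_den a b q p k * q.

End Elliptic.

Section Boards.
Variable n : nat.

(* Indices are 0-based: [c : cell] is the cell (i, j) = (c.1 + 1, c.2 + 1), in
   the column i (from the left) and the row j (from the bottom). *)
Definition cell := ('I_n * 'I_n)%type.

Definition rownum (c : cell) : nat := c.2.+1.

(* The board B(b_1, ..., b_n) with b_(i+1) = bs i; it contains all its cells
   only when every [bs i] is at most [n]. *)
Definition column_board (bs : 'I_n -> nat) : {set cell} :=
  [set c : cell | (rownum c <= bs c.1)%N].

Definition file_placements (B : {set cell}) (k : nat) : {set {set cell}} :=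
  [set Q : {set cell} | [&& Q \subset B, #|Q| == k &
     [forall c in Q, forall d in Q, (c.1 == d.1) ==> (c == d)]]].

Definition cancelled (Q : {set cell}) (c : cell) : bool :=
  [exists d in Q, (d.1 == c.1) && (rownum c < rownum d)%N].

Definition uncancelled (B Q : {set cell}) : {set cell} :=
  [set c in B :\: Q | ~~ cancelled Q c].

Definition file_number (R : realType) (a b q p : R[i]) (B : {set cell})
    (k : nat) : R[i] :=
  \sum_(Q in file_placements B k)
    \prod_(c in uncancelled B Q) ellweight a b q p (1 - (rownum c)%:Z).

End Boards.

(* Main.v *)
Require Import Defs.
From HB Require Import structures.
From mathcomp Require Import all_boot all_order all_algebra.
From mathcomp Require Import complex.
From mathcomp Require Import all_classical all_reals all_analysis.
From mathcomp Require Import ring zify.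

Set Implicit Arguments.
Unset Strict Implicit.
Unset Printing Implicit Defensive.

Import Order.TTheory GRing.Theory Num.Theory.
Import numFieldNormedType.Exports.
Import ComplexField.Normc.

Local Open Scope ring_scope.

(* Each column contributes independently to a file placement, so the right-hand
   side factors as the product over the columns of W_i [z] + S_i, where W_i is
   the weight of the empty column and S_i sums the weights over the positions of
   one rook.  That [z + b_i] = W_i [z] + S_i follows by induction on b_i from
     [z+1]_{A q^-2, B q^-1} = w [z]_{A,B} + 1,
   which is Weierstrass' addition formula for theta.  The addition formula holds
   because, by the Jacobi triple product and a splitting of the double series
   according to parity, theta(xy) theta(x/y) / x is a 2 x 2 determinant in x
   and y, so that the formula is a Pluecker relation. *)

(** * Convergence of complex sequences *)

(* Stated over an abstract [numFieldType]: on [R[i]] itself, unification gets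
   lost between the topological structures. *)
Lemma cvg_seqD (K : numFieldType) (u v : nat -> K) (c d : K) :
  (u @ \oo --> c -> v @ \oo --> d -> (fun n => u n + v n) @ \oo --> c + d)%classic.
Proof. by move=> uc vd; exact: cvgD uc vd. Qed.

Lemma cvg_seqM (K : numFieldType) (u v : nat -> K) (c d : K) :
  (u @ \oo --> c -> v @ \oo --> d -> (fun n => u n * v n) @ \oo --> c * d)%classic.
Proof. by move=> uc vd; exact: cvgM uc vd. Qed.

Lemma limn_unique (K : numFieldType) (u : nat -> K) (c : K) :
  (u @ \oo --> c -> limn u = c)%classic.
Proof. by move=> uc; apply: cvg_lim uc; exact: norm_hausdorff. Qed.

Section ComplexSequences.
Variable R : realType.
Local Notation C := R[i].
Local Notation K := (C : numFieldType).
Implicit Types u v : nat -> K.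
Local Open Scope classical_set_scope.
Local Open Scope complex_scope.

Lemma normc_ge0 (x : C) : 0 <= normc x.
Proof. by case: x => a b; rewrite /normc sqrtr_ge0. Qed.

Lemma cvg_normc u (c : K) :
  u @ \oo --> c <-> normc (u n - c) @[n --> \oo] --> (0 : R).
Proof.
split.
- move=> uc; apply/cvgr0Pnorm_lt => e e0.
  have := (cvgrPdist_lt _ _).1 uc e%:C; rewrite ltcR => /(_ _ e0).
  apply: filterS => n; rewrite distrC.
  rewrite [`|_ : K|]/(normc _)%:C ltcR => h.
  by rewrite ger0_norm // normc_ge0.
- move=> uc; apply/cvgrPdist_lt => e.
  (* A positive element of [R[i]] has zero imaginary part, so the real part of [e] serves as the
     radius. *)
  rewrite ltcE/= => /andP[/eqP ie re].
  have /cvgr0Pnorm_lt/(_ _ re) := uc.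
  apply: filterS => n; rewrite distrC => h.
  rewrite [`|_ : K|]/(normc _)%:C ltcE /= -ie eqxx /=.
  by apply: le_lt_trans h; rewrite ler_norm.
Qed.

Lemma normcX (x : C) n : normc (x ^+ n) = normc x ^+ n.
Proof. by elim: n => [|n IH]; rewrite ?normc1 // !exprS normcM IH. Qed.

Lemma le_normc_sum (I : Type) (s : seq I) (f : I -> C) :
  normc (\sum_(i <- s) f i) <= \sum_(i <- s) normc (f i).
Proof.
elim/big_rec2: _ => [|i y1 y2 _ IH]; first by rewrite normc0.
by apply: le_trans (le_normcD _ _) _; rewrite lerD2l.
Qed.

(* Convergence in [C]; the indirection through the real-valued [normc] keeps
   the several topologies inferred on [R[i]] out of the sequel. *)
Definition converges (u : nat -> C) (c : C) : Prop :=
  normc (u n - c) @[n --> \oo] --> (0 : R).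

Lemma convergesP (u : nat -> C) (c : C) :
  converges u c <-> (u : nat -> K) @ \oo --> (c : K).
Proof. by split => /cvg_normc. Qed.

Lemma converges_ext (u v : nat -> C) c : converges u c -> u =1 v -> converges v c.
Proof. by move=> uc /funext <-. Qed.

Lemma converges_cst (c : C) : converges (fun=> c) c.
Proof. by apply/convergesP; exact: cvg_cst. Qed.

Lemma convergesD (u v : nat -> C) c d :
  converges u c -> converges v d -> converges (fun n => u n + v n) (c + d).
Proof. by move=> /convergesP uc /convergesP vd; apply/convergesP; exact: cvg_seqD. Qed.

Lemma convergesM (u v : nat -> C) c d :
  converges u c -> converges v d -> converges (fun n => u n * v n) (c * d).
Proof. by move=> /convergesP uc /convergesP vd; apply/convergesP; exact: cvg_seqM. Qed.

Lemma converges_unique (u : nat -> C) c d : converges u c -> converges u d -> c = d.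
Proof.
move=> /convergesP uc /convergesP ud.
by rewrite -(limn_unique uc) (limn_unique ud).
Qed.

Lemma converges_near (u v : nat -> C) c N0 :
  converges u c -> (forall N, (N0 <= N)%N -> u N = v N) -> converges v c.
Proof.
move=> uc uv; apply: cvg_trans uc; apply: near_eq_cvg.
by exists N0 => // N /= hN; rewrite uv.
Qed.

Lemma converges_le (u : nat -> C) (c : C) (v : nat -> R) :
  (forall n, normc (u n - c) <= v n) -> v @ \oo --> (0 : R) -> converges u c.
Proof.
move=> uv v0.
apply: (@squeeze_cvgr _ _ _ _ (fun=> 0) v) => //; last exact: cvg_cst.
by apply: nearW => n; rewrite normc_ge0 uv.
Qed.

Lemma cvg_bounded_normc (u : nat -> C) (c : C) :
  converges u c -> exists M : R, forall n, normc (u n) <= M.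
Proof.
move=> uc.
have : cvgn (fun n => normc (u n - c)).
  by apply/cvg_ex; exists 0.
move=> /cvg_seq_bounded [M [_ /(_ (M + 1))]].
rewrite ltrDl ltr01 => /(_ isT) HM.
exists (M + 1 + normc c) => n.
rewrite -[u n](subrK c); apply: le_trans (le_normcD _ _) _.
rewrite lerD2r; apply: le_trans (HM n I).
exact: ler_norm.
Qed.

Lemma le_Re_normc (x : C) : `|complex.Re x| <= normc x.
Proof.
by case: x => a b /=; rewrite -sqrtr_sqr ler_sqrt ?lerDl ?sqr_ge0 // addr_ge0 ?sqr_ge0.
Qed.

Lemma le_Im_normc (x : C) : `|complex.Im x| <= normc x.
Proof.
by case: x => a b /=; rewrite -sqrtr_sqr ler_sqrt ?lerDr ?sqr_ge0 // addr_ge0 ?sqr_ge0.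
Qed.

Lemma normc_le_ReIm (x : C) : normc x <= `|complex.Re x| + `|complex.Im x|.
Proof.
case: x => a b /=.
have h : 0 <= `|a| + `|b| by rewrite addr_ge0.
rewrite -[leRHS]ger0_norm // -sqrtr_sqr ler_sqrt ?sqr_ge0 //.
rewrite sqrrD !real_normK ?num_real // -addrA lerD2l addrC.
by rewrite lerDl mulrn_wge0 // mulr_ge0.
Qed.

(** The series of increments is dominated by a geometric series, and its partial sums telescope to
    [w n - w 0]. *)
Lemma cvg_geometric_steps (w : nat -> R) (D r : R) : 0 <= r < 1 ->
  (forall n, `|w n.+1 - w n| <= D * r ^+ n) -> cvgn w.
Proof.
move=> /andP[r0 r1] hw.
have cs : cvgn (series (fun n => w n.+1 - w n)).
  apply: normed_cvg.
  apply: (@series_le_cvg _ _ (geometric D r)) => //= n.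
    by apply: le_trans (hw n); rewrite normr_ge0.
  by apply: is_cvg_geometric_series; rewrite ger0_norm.
rewrite -[w](_ : cst (w 0%N) + series (fun n => w n.+1 - w n) = _).
  by apply: is_cvgD => //; exact: is_cvg_cst.
apply/funext => n /=; rewrite fctE /series /= telescope_sumr //.
by rewrite /cst addrC subrK.
Qed.

Lemma cvgC_geometric_steps (u : nat -> C) (D r : R) : 0 <= r < 1 ->
  (forall n, normc (u n.+1 - u n) <= D * r ^+ n) ->
  exists c : C, converges u c.
Proof.
move=> hr hu.
have cr : cvgn (fun n => complex.Re (u n)).
  apply: (cvg_geometric_steps hr) => n; apply: le_trans (hu n).
  rewrite -raddfB; exact: le_Re_normc.
have ci : cvgn (fun n => complex.Im (u n)).
  apply: (cvg_geometric_steps hr) => n; apply: le_trans (hu n).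
  rewrite -raddfB; exact: le_Im_normc.
move: cr ci => /cvg_ex[a ha] /cvg_ex[b hb].
exists (a +i* b).
apply: (@converges_le _ _ (fun n => `|complex.Re (u n) - a| + `|complex.Im (u n) - b|)).
  by move=> n; apply: le_trans (normc_le_ReIm _) _; rewrite !raddfB.
rewrite -[0](addr0 0); apply: cvgD; apply/norm_cvg0P; by apply/subr_cvg0.
Qed.

Lemma geometric_sum_le (r : R) a m : 0 <= r < 1 ->
  \sum_(a <= k < a + m) r ^+ k <= r ^+ a / (1 - r).
Proof.
move=> /andP[r0 r1]; rewrite ler_pdivlMr ?subr_gt0 //.
have -> : (\sum_(a <= k < a + m) r ^+ k) * (1 - r) = r ^+ a - r ^+ (a + m).
  elim: m => [|m IHm]; first by rewrite addn0 big_geq // mul0r subrr.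
  by rewrite addnS big_nat_recr ?leq_addr //= mulrDl IHm exprSr; ring.
by rewrite gerBl exprn_ge0.
Qed.

(** Since 1 + x <= exp x, the partial products are bounded by exp(D / (1 - r)); consecutive ones
    therefore differ by at most a constant times r^n. *)
Lemma cvg_prod1D (a : nat -> C) (D r : R) : 0 <= r < 1 ->
  (forall n, normc (a n) <= D * r ^+ n) ->
  exists c : C, converges (fun N => \prod_(0 <= j < N) (1 + a j)) c.
Proof.
move=> /andP[r0 r1] ha.
have D0 : 0 <= D by have := ha 0%N; rewrite expr0 mulr1; apply: le_trans (normc_ge0 _).
pose P N := \prod_(0 <= j < N) (1 + a j).
have bP N : normc (P N) <= expR (D / (1 - r)).
  apply: (@le_trans _ _ (expR (\sum_(0 <= j < N) D * r ^+ j))).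
    rewrite /P; elim: N => [|N IH]; first by rewrite !big_geq // normc1 expR0.
    rewrite !big_nat_recr //= normcM expRD.
    apply: ler_pM => //; rewrite ?normc_ge0 //.
    apply: le_trans (expR_ge1Dx _).
    by apply: le_trans (le_normcD _ _) _; rewrite normc1 lerD2l.
  rewrite ler_expR -mulr_sumr ler_wpM2l //.
  by rewrite -(mul1r (_^-1)) -(expr0 r) (geometric_sum_le 0) ?r0.
apply: (@cvgC_geometric_steps _ (expR (D / (1 - r)) * D) r); first by rewrite r0.
move=> n; rewrite big_nat_recr //= -/(P n) mulrDr mulr1 addrC addKr normcM -mulrA.
by apply: ler_pM; rewrite ?normc_ge0.
Qed.

(** Dominated convergence: the first k0 terms tend to 0 one by one, while the tail from k0 on is at
    most M D r^k0 / (1 - r), whatever [N] and [L]. *)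
Lemma tannery (g : nat -> nat -> C) (t : nat -> C) (L : nat -> nat) (M D r : R) :
  0 <= r < 1 ->
  (forall k, normc (t k) <= D * r ^+ k) ->
  (forall N k, normc (g N k) <= M) ->
  (forall k, converges (g ^~ k) 0) ->
  converges (fun N => \sum_(k < L N) g N k * t k) 0.
Proof.
move=> /andP[r0 r1] ht hg cg.
have D0 : 0 <= D by have := ht 0%N; rewrite expr0 mulr1; apply: le_trans (normc_ge0 _).
have M0 : 0 <= M by apply: le_trans (hg 0 0)%N; rewrite normc_ge0.
apply/cvgr0Pnorm_lt => e e0.
have rK : (fun k => M * (D / (1 - r)) * r ^+ k) @ \oo --> (0 : R).
  by apply: (@cvg_geometric R); rewrite ger0_norm.
have e20 : 0 < e / 2 by rewrite divr_gt0.
have /cvgr0Pnorm_lt/(_ _ e20)[k0 _ /(_ k0 (leqnn _)) Hk0] := rK.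
have hd : (fun N => \sum_(k < k0) (normc (g N k) * normc (t k))) @ \oo --> (0 : R).
  rewrite [X in _ --> X](_ : _ = \sum_(k < k0) (0 * normc (t k))); last first.
    by rewrite big1 // => i _; rewrite mul0r.
  apply: cvg_big => [|k _]; first exact: add_continuous.
  apply: cvgM; last exact: cvg_cst.
  have := cg k; rewrite /converges; under eq_cvg do rewrite subr0.
  by [].
have /cvgr0Pnorm_lt/(_ _ e20) := hd.
apply: filterS => N hN.
rewrite subr0 ger0_norm ?normc_ge0 //.
apply: (@le_lt_trans _ _ (\sum_(k < k0) (normc (g N k) * normc (t k)) +
    M * (D / (1 - r)) * r ^+ k0)); last first.
  rewrite [ltRHS](splitr e); apply: ltrD.
    by apply: le_lt_trans hN; rewrite ler_norm.
  by apply: le_lt_trans Hk0; rewrite ler_norm.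
apply: (@le_trans _ _ (\sum_(k < L N) normc (g N k) * normc (t k))).
  by apply: le_trans (le_normc_sum _ _) _; under eq_bigr do rewrite normcM.
(* The range is enlarged to [k0 + L N] so that it can be cut at [k0] even when [L N < k0]. *)
apply: (@le_trans _ _ (\sum_(0 <= k < k0 + L N) normc (g N k) * normc (t k))).
  rewrite addnC -(big_mkord xpredT (fun k => normc (g N k) * normc (t k))).
  rewrite (@big_cat_nat _ _ _ (L N) 0 (L N + k0)) //= ?leq_addr // lerDl.
  by apply: sumr_ge0 => k _; rewrite mulr_ge0 // normc_ge0.
rewrite (@big_cat_nat _ _ _ k0) //= ?leq_addr // big_mkord lerD2l.
apply: (@le_trans _ _ (M * D * \sum_(k0 <= k < k0 + L N) r ^+ k)).
  rewrite mulr_sumr; apply: ler_sum => k _; rewrite -mulrA.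
  by apply: ler_pM; rewrite ?normc_ge0.
apply: le_trans (ler_wpM2l _ (geometric_sum_le k0 (L N) _)) _; rewrite ?mulr_ge0 ?r0 //.
by rewrite le_eqVlt; apply/orP; left; apply/eqP; ring.
Qed.

End ComplexSequences.

(** * The truncated theta function *)

Section FiniteTheta.
Variable F : fieldType.
Variable p : F.

(** Defined by the q-Pascal rule instead of a quotient, so that the q-binomial theorem holds even
    where [qpoch] vanishes. *)
Fixpoint gauss_binomial (M k : nat) : F :=
  match M, k with
  | _, 0 => 1
  | 0, _.+1 => 0
  | M'.+1, k'.+1 => p ^+ k'.+1 * gauss_binomial M' k'.+1 + gauss_binomial M' k'
  end.

(** The q-Pochhammer symbol (p;p)_k. *)
Definition qpoch (k : nat) : F := \prod_(0 <= j < k) (1 - p ^+ j.+1).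

Lemma gauss_binomial0 M : gauss_binomial M 0 = 1.
Proof. by case: M. Qed.

Lemma gauss_binomial_small M k : (M < k)%N -> gauss_binomial M k = 0.
Proof.
elim: M k => [|M IH] [|k] //= Mk.
by rewrite !IH ?mulr0 ?addr0 // ltnW.
Qed.

(** The q-Pascal rule reduces this to 1 - p^(M+1) = p^(k+1) (1 - p^(M-k)) + (1 - p^(k+1)). *)
Lemma gauss_binomial_qpoch M k : (k <= M)%N ->
  gauss_binomial M k * (qpoch k * qpoch (M - k)) = qpoch M.
Proof.
elim: M k => [|M IH] [|k] //= kM.
- by rewrite /qpoch big_geq // !mulr1.
- by rewrite subn0 /qpoch big_geq // !mul1r.
have qS j : qpoch j.+1 = qpoch j * (1 - p ^+ j.+1) by rewrite /qpoch big_nat_recr.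
rewrite subSS; move: kM; rewrite ltnS leq_eqVlt => /orP[/eqP->|kM].
  rewrite gauss_binomial_small // mulr0 add0r !qS -[in RHS](IH M) //; ring.
have := IH _ kM; have := IH _ (ltnW kM); rewrite !qS => h1 h2.
have e : (M - k = (M - k.+1).+1)%N by rewrite subnS prednK // subn_gt0.
have -> : p ^+ M.+1 = p ^+ k.+1 * p ^+ (M - k.+1).+1 by rewrite -exprD -e; congr (_ ^+ _); lia.
rewrite mulrDl.
transitivity (p ^+ k.+1 * (1 - p ^+ (M - k.+1).+1) * qpoch M + qpoch M * (1 - p ^+ k.+1)).
  congr (_ + _); last by rewrite -h1; ring.
  rewrite -[in RHS]h2 e qS; ring.
ring.
Qed.

(** Splitting off the factor j = 0 leaves a product with one factor less, taken at [p * w];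
    comparing coefficients gives the q-Pascal rule. *)
Lemma qbinomial M w : \prod_(0 <= j < M) (1 + p ^+ j * w) =
  \sum_(0 <= k < M.+1) gauss_binomial M k * p ^+ 'C(k, 2) * w ^+ k.
Proof.
elim: M w => [|M IH] w; first by rewrite big_geq // big_nat1 /= !mulr1.
rewrite big_nat_recl // expr0 mul1r.
rewrite (eq_bigr (fun j => 1 + p ^+ j * (p * w))); last first.
  by move=> j _; rewrite exprSr mulrA.
rewrite IH mulrDl mul1r.
rewrite [RHS]big_nat_recl // gauss_binomial0 bin0n /=.
rewrite [X in X + _]big_nat_recl // gauss_binomial0 /=.
have -> : \sum_(0 <= i < M) gauss_binomial M i.+1 * p ^+ 'C(i.+1, 2) * (p * w) ^+ i.+1 =
    \sum_(0 <= i < M.+1) gauss_binomial M i.+1 * p ^+ 'C(i.+1, 2) * (p * w) ^+ i.+1.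
  by rewrite [RHS]big_nat_recr //= gauss_binomial_small // !mul0r addr0.
rewrite !expr0 -addrA; congr (_ + _).
rewrite mulr_sumr -big_split /=; apply: eq_bigr => k _.
by rewrite binS bin1 exprD !exprMn !exprS; ring.
Qed.

Definition theta_trunc (x : F) (N : nat) : F :=
  \prod_(0 <= j < N) ((1 - p ^+ j * x) * (1 - p ^+ j.+1 / x)).

(** This is m (m - 1) / 2 as a natural number; at m = -(k + 1) it equals (k + 1)(k + 2) / 2. *)
Definition tri (m : int) : nat :=
  match m with Posz k => 'C(k, 2) | Negz k => 'C(k.+2, 2) end.

Lemma bin2E k : ('C(k, 2)%:Z *+ 2 = k%:Z * (k%:Z - 1)).
Proof.
elim: k => [|k IH]; first by rewrite mul0r.
rewrite binS bin1 PoszD mulrnDl IH intS; ring.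
Qed.

Lemma triE m : (tri m)%:Z *+ 2 = m * (m - 1).
Proof.
case: m => k; first exact: bin2E.
by rewrite /tri bin2E NegzE !intS; ring.
Qed.

Definition theta_term (x : F) (m : int) : F := p ^+ tri m * (- x) ^ m.

(** The indicator guards against [absz]: for m < -N the index |N + m| may again lie between 0 and
    2N. *)
Definition theta_coef (N : nat) (m : int) : F :=
  (absz m <= N)%:R * gauss_binomial (N + N) (absz (N%:Z + m)).

(* Finite Jacobi triple product: the q-binomial theorem at [w = - x p^-N]. *)
Lemma theta_trunc_sum x N : p != 0 -> x != 0 ->
  theta_trunc x N = \sum_(m <- [seq k%:Z - N%:Z | k <- iota 0 (N + N).+1])
     theta_coef N m * theta_term x m.
Proof.
move=> p0 x0.
have x0' : - x != 0 by rewrite oppr_eq0.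
have H : theta_trunc x N = (\sum_(0 <= k < (N + N).+1)
    gauss_binomial (N + N) k * p ^+ 'C(k, 2) * (- x / p ^+ N) ^+ k) *
    (p ^+ 'C(N.+1, 2) * (- x) ^- N).
  (* The lower N factors are 1 - x p^(j-N) = -x p^(j-N) (1 - p^(N-j) / x), whose monomials are
     cleared by p^C(N+1,2) (-x)^-N; the upper N are the factors in x. *)
  rewrite -qbinomial [in RHS](@big_cat_nat _ _ _ N) ?leq_addr //=.
  have -> : \prod_(N <= j < N + N) (1 + p ^+ j * (- x / p ^+ N)) =
      \prod_(0 <= j < N) (1 - p ^+ j * x).
    rewrite -[in LHS](add0n N) big_addn addnK; apply: eq_bigr => j _.
    by rewrite exprD; field; rewrite ?expf_neq0.
  have -> : \prod_(0 <= j < N) (1 + p ^+ j * (- x / p ^+ N)) *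
      \prod_(0 <= j < N) (1 - p ^+ j * x) * (p ^+ 'C(N.+1, 2) * (- x) ^- N) =
      theta_trunc x N; last by [].
    rewrite /theta_trunc big_split /= mulrAC [RHS]mulrC; congr (_ * _).
    elim: N => [|N IH]; first by rewrite !big_geq // expr0 invr1 !mulr1.
    rewrite [RHS]big_nat_recr //= -IH big_nat_recl //.
    rewrite (eq_bigr (fun j => 1 + p ^+ j * (- x / p ^+ N))); last first.
      by move=> j _; rewrite !exprS; field; rewrite p0 expf_neq0.
    rewrite binS bin1 exprD !exprS expr0 -!mulrA mulrCA; congr (_ * _).
    by field; rewrite ?x0 ?x0' ?p0 ?expf_neq0.
rewrite H big_map big_distrl; apply: eq_big_seq => k /=.
rewrite mem_index_iota => /andP[_ kN].
rewrite /theta_coef.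
have -> : (absz (k%:Z - N%:Z) <= N)%N by lia.
have -> : absz (N%:Z + (k%:Z - N%:Z)) = k by lia.
rewrite mul1r -!mulrA; congr (_ * _).
rewrite /theta_term expfzDr //.
have e : ('C(k, 2) + 'C(N.+1, 2) = tri (k%:Z - N%:Z) + N * k)%N.
  have := triE (k%:Z - N%:Z); have := bin2E k; have := bin2E N.+1.
  nia.
rewrite -exprnN -exprnP exprMn exprVn -exprM.
apply: (mulIf (expf_neq0 (N * k) p0)).
rewrite [RHS]mulrAC -exprD -e exprD. field.
by rewrite expf_neq0 // expf_neq0.
Qed.

Definition int_range (L : nat) : seq int :=
  map Posz (iota 0 L) ++ map Negz (iota 0 L).

Lemma mem_int_range L (m : int) : (m \in int_range L) = (- L%:Z <= m < L%:Z).
Proof.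
rewrite mem_cat; case: m => k.
  rewrite mem_map ?mem_iota; last by move=> ? ? [].
  rewrite add0n [X in _ || X](_ : _ = false) ?orbF; first by lia.
  by apply/mapP => -[].
rewrite orbC mem_map ?mem_iota; last by move=> ? ? [].
rewrite [X in _ || X](_ : _ = false) ?orbF; last by apply/mapP => -[].
by rewrite NegzE; lia.
Qed.

Lemma int_range_uniq L : uniq (int_range L).
Proof.
rewrite cat_uniq !map_inj_uniq ?iota_uniq ?andbT //=; try by move=> ? ? [].
by apply/hasPn => m /mapP[k _ ->]; apply/mapP => -[].
Qed.

Lemma big_uniq_subset (V : pzRingType) (I : eqType) (s t : seq I) (f : I -> V) :
  uniq s -> uniq t -> {subset s <= t} ->
  \sum_(i <- s) f i = \sum_(i <- t) (i \in s)%:R * f i.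
Proof.
move=> us ut st.
transitivity (\sum_(i <- [seq i <- t | i \in s]) f i).
  apply: perm_big; apply: uniq_perm; rewrite ?filter_uniq //.
  by move=> i; rewrite mem_filter andb_idr //; exact: st.
rewrite big_filter big_mkcond; apply: eq_bigr => i _.
by case: (i \in s); rewrite ?mul1r ?mul0r.
Qed.

(** [theta_coef N m] vanishes for |m| > N, so the range can grow. This puts two theta factors on a
    common square of indices containing [parity_pairs N]. *)
Lemma theta_trunc_int_range x N L : p != 0 -> x != 0 -> (N < L)%N ->
  theta_trunc x N = \sum_(m <- int_range L) theta_coef N m * theta_term x m.
Proof.
move=> p0 x0 NL; rewrite theta_trunc_sum //.
rewrite (@big_uniq_subset _ _ _ (int_range L)) ?int_range_uniq //; last first.
- by move=> m /mapP[k]; rewrite mem_iota mem_int_range => hk ->; lia.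
- rewrite map_inj_uniq ?iota_uniq // => i j; lia.
apply: eq_bigr => m _; rewrite mulrA; congr (_ * _).
case: (boolP (m \in _)); rewrite ?mul1r // mul0r /theta_coef => /mapP h.
case: leqP => mN; rewrite ?mul0r //; case: h.
exists (absz (m + N%:Z)); first by rewrite mem_iota; lia.
lia.
Qed.

(* Substituting m = i + j, n = i - j or m = i + j, n = i - j + 1 according to
   the parity of m + n in the double series of theta(xy) theta(x/y) separates
   the variables x and y. *)
Definition parity_pairs (N : nat) : seq (int * int) :=
  [seq (i + j, i - j) | i <- int_range N, j <- int_range N] ++
  [seq (i + j, i - j + 1) | i <- int_range N, j <- int_range N].

Lemma parity_pairs_uniq N : uniq (parity_pairs N).
Proof.
rewrite cat_uniq !allpairs_uniq ?int_range_uniq //=; first last.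
- by move=> [i j] [i' j'] _ _ /= [] h1 h2; congr pair; lia.
- by move=> [i j] [i' j'] _ _ /= [] h1 h2; congr pair; lia.
rewrite andbT; apply/hasPn => c /allpairsPdep[i [j /= [_ _ ->]]].
by apply/negP => /allpairsPdep[i' [j' /= [_ _ [h1 h2]]]]; lia.
Qed.

Lemma parity_pairs_sub N :
  {subset parity_pairs N <=
    [seq (m, n) | m <- int_range (N + N).+1, n <- int_range (N + N).+1]}.
Proof.
move=> c; rewrite mem_cat => /orP[] /allpairsPdep[i [j [hi hj ->]]];
  move: hi hj; rewrite !mem_int_range => hi hj;
  apply: allpairs_f; rewrite mem_int_range; lia.
Qed.

(** Take i = floor((m + n) / 2) and j = m - i. Hence each fixed pair belongs to [parity_pairs N] for
    all large [N]. *)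
Lemma mem_parity_pairs N (m n : int) :
  (absz m + absz n < N)%N -> (m, n) \in parity_pairs N.
Proof.
move=> h; rewrite mem_cat.
have [k [e|e]] : exists k : int, m + n = k + k \/ m + n = k + k + 1.
  exists ((m + n) %/ 2)%Z; have := divz_eq (m + n) 2.
  have := modz_ge0 (m + n) (isT : 2 != 0 :> int).
  have := ltz_pmod (m + n) (isT : 0 < 2 :> int). lia.
- apply/orP; left; apply/allpairsPdep; exists k, (m - k).
  by rewrite !mem_int_range; split; [lia|lia|congr pair; lia].
- apply/orP; right; apply/allpairsPdep; exists k, (m - k).
  by rewrite !mem_int_range; split; [lia|lia|congr pair; lia].
Qed.

(** Up to the factor (p^2;p^2) of infinite order, a truncation of theta(-x^2; p^2); [theta_sum2] is
    likewise one of theta(-p x^2; p^2). *)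
Definition theta_sum1 (N : nat) (x : F) : F :=
  \sum_(i <- int_range N) p ^+ absz (i * (i - 1)) * x ^ (i + i).

Definition theta_sum2 (N : nat) (x : F) : F :=
  \sum_(i <- int_range N) p ^+ absz (i * i) * x ^ (i + i).

Definition theta_pair (N : nat) (x y : F) : F :=
  theta_sum1 N x * theta_sum2 N y - x / y * (theta_sum2 N x * theta_sum1 N y).

Lemma theta_term_mul x y m n : x != 0 -> y != 0 ->
  theta_term (x * y) m * theta_term (x / y) n =
  p ^+ (tri m + tri n) * ((- x) ^ (m + n) * y ^ (m - n)).
Proof.
move=> x0 y0; have x0' : - x != 0 by rewrite oppr_eq0.
rewrite /theta_term -!mulNr !expfzMl !expfzDr // exprz_inv exprD; ring.
Qed.

(** The exponent [tri m + tri n] is i (i - 1) + j^2 on the first family of pairs and i^2 + j (j - 1)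
    on the second, so each double sum factors. The odd power of [- x] in the second gives the minus
    sign. *)
Lemma theta_pairE N x y : x != 0 -> y != 0 ->
  theta_pair N x y = \sum_(c <- parity_pairs N)
    theta_term (x * y) c.1 * theta_term (x / y) c.2.
Proof.
move=> x0 y0.
have neg2 (i : int) : (- x) ^ (i + i) = x ^ (i + i).
  by rewrite !expfzDr ?oppr_eq0 // -!expfzMl mulrNN.
rewrite big_cat /= !big_allpairs_dep /=; congr (_ + _).
  rewrite mulr_suml; apply: eq_bigr => i _; rewrite mulr_sumr; apply: eq_bigr => j _.
  rewrite theta_term_mul //.
  have -> : i + j + (i - j) = i + i by lia.
  have -> : i + j - (i - j) = j + j by lia.
  have -> : (tri (i + j)%R + tri (i - j)%R = absz (i * (i - 1))%R + absz (j * j)%R)%N.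
    have := triE (i + j); have := triE (i - j); nia.
  by rewrite exprD neg2; ring.
rewrite mulr_suml mulr_sumr -sumrN; apply: eq_bigr => i _.
rewrite !mulr_sumr -sumrN; apply: eq_bigr => j _.
rewrite theta_term_mul //.
have -> : i + j + (i - j + 1) = i + i + 1 by lia.
have -> : i + j - (i - j + 1) = j + j - 1 by lia.
have -> : (tri (i + j)%R + tri (i - j + 1)%R = absz (i * i)%R + absz (j * (j - 1))%R)%N.
  have := triE (i + j); have := triE (i - j + 1); nia.
rewrite exprD [(- x) ^ _]expfzDr ?oppr_eq0 // neg2 expr1z [y ^ (_ - 1)]expfzDr // exprN1.
by ring.
Qed.

(* [theta_pair N x y / x] is a 2 x 2 determinant of functions of [x] and [y]. *)
Lemma theta_pair_plucker N x y u v : x != 0 -> y != 0 -> u != 0 -> v != 0 ->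
  theta_pair N x v * theta_pair N u y =
  theta_pair N x y * theta_pair N u v +
  u / v * (theta_pair N v y * theta_pair N x u).
Proof.
move=> x0 y0 u0 v0; rewrite /theta_pair; field.
by rewrite v0 y0 u0.
Qed.

End FiniteTheta.

(** * The addition formula *)

Section ThetaLimit.
Variable R : realType.
Local Notation C := R[i].
Local Open Scope classical_set_scope.
Local Open Scope complex_scope.

Definition geometric_decay (t : int -> C) (D r : R) :=
  forall k, normc (t (Posz k)) <= D * r ^+ k /\ normc (t (Negz k)) <= D * r ^+ k.

Lemma sum_int_range (V : nmodType) (f : int -> V) L :
  \sum_(m <- int_range L) f m = \sum_(k < L) f (Posz k) + \sum_(k < L) f (Negz k).
Proof.
rewrite big_cat !big_map /=.
rewrite -(big_mkord xpredT (fun k => f (Posz k))) -(big_mkord xpredT (fun k => f (Negz k))).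
by rewrite /index_iota subn0.
Qed.

Lemma tannery_int (g : nat -> int -> C) (t : int -> C) (L : nat -> nat) (M D r : R) :
  0 <= r < 1 -> geometric_decay t D r ->
  (forall N m, normc (g N m) <= M) ->
  (forall m, converges (g ^~ m) 0) ->
  converges (fun N => \sum_(m <- int_range (L N)) g N m * t m) 0.
Proof.
move=> hr ht hg cg.
have h1 := @tannery R (fun N k => g N (Posz k)) (fun k => t (Posz k)) L M D r
  hr (fun k => (ht k).1) (fun N k => hg N _) (fun k => cg _).
have h2 := @tannery R (fun N k => g N (Negz k)) (fun k => t (Negz k)) L M D r
  hr (fun k => (ht k).2) (fun N k => hg N _) (fun k => cg _).
have := convergesD h1 h2; rewrite addr0 => h; apply: (converges_ext h) => N.
by rewrite sum_int_range.
Qed.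

(** The bound is uniform in [L], so the inner sum of a double series can act as a bounded
    coefficient in [tannery_int]. *)
Lemma sum_geometric_decay_le (g t : int -> C) (L : nat) (M D r : R) :
  0 <= r < 1 -> geometric_decay t D r -> (forall m, normc (g m) <= M) ->
  normc (\sum_(m <- int_range L) g m * t m) <= M * (D / (1 - r)) *+ 2.
Proof.
move=> hr ht hg.
have M0 : 0 <= M by apply: le_trans (hg 0); rewrite normc_ge0.
have D0 : 0 <= D by have [+ _] := ht 0%N; rewrite expr0 mulr1; apply: le_trans (normc_ge0 _).
have half (s : nat -> int) : (forall k, normc (t (s k)) <= D * r ^+ k) ->
    normc (\sum_(k < L) g (s k) * t (s k)) <= M * (D / (1 - r)).
  move=> hs; apply: le_trans (le_normc_sum _ _) _.
  apply: (@le_trans _ _ (\sum_(0 <= k < 0 + L) M * D * r ^+ k)).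
    rewrite add0n big_mkord; apply: ler_sum => k _; rewrite normcM -mulrA.
    by apply: ler_pM; rewrite ?normc_ge0.
  rewrite -mulr_sumr mulrA -mulrA.
  have := geometric_sum_le 0 L hr; rewrite expr0 mul1r => h.
  by rewrite -!mulrA; apply: ler_wpM2l => //; apply: ler_wpM2l.
rewrite sum_int_range mulr2n; apply: le_trans (le_normcD _ _) _.
by apply: lerD; apply: half => k; case: (ht k).
Qed.

Lemma converges_eventually (b : nat -> bool) (N0 : nat) :
  (forall N, (N0 <= N)%N -> b N) -> converges (fun N => (b N)%:R) (1 : C).
Proof.
by move=> hb; apply: (converges_near (converges_cst 1) (N0 := N0)) => N /hb->.
Qed.

Lemma converges_comp (u : nat -> C) (c : C) (s : nat -> nat) (N0 : nat) :
  (forall n N, (n + N0 <= N)%N -> (n <= s N)%N) ->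
  converges u c -> converges (u \o s) c.
Proof.
move=> hs uc; apply: (cvg_comp s (fun n => normc (u n - c)) _ uc).
by move=> A [n0 _ hA]; exists (n0 + N0)%N => // N /= hN; apply: hA; exact: hs.
Qed.

Section Theta.
Variable p : C.
Hypothesis p_lt1 : normc p < 1.

Let hp : 0 <= normc p < 1. Proof. by rewrite normc_ge0. Qed.

Lemma cvg_prod_geometric (c : C) :
  exists l : C, converges (fun N => \prod_(0 <= j < N) (1 + p ^+ j * c)) l.
Proof.
apply: (@cvg_prod1D _ _ (normc c) (normc p)) => // n.
by rewrite normcM normcX mulrC.
Qed.

(** Shows that the [limn] in [theta] is a genuine limit: the products in x and in 1/x converge
    separately. *)
Lemma theta_cvg (x : C) : converges (theta_trunc p x) (theta p x).
Proof.
have [l1 h1] := cvg_prod_geometric (- x).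
have [l2 h2] := cvg_prod_geometric (- (p / x)).
suff h : converges (theta_trunc p x) (l1 * l2).
  by rewrite /theta (limn_unique ((convergesP _ _).1 h)).
apply: (converges_ext (convergesM h1 h2)) => N; rewrite /= /theta_trunc -big_split.
apply: eq_bigr => j _ /=.
by rewrite !mulrN exprSr mulrA.
Qed.

Lemma normc_1B_ge k : 1 - normc p <= normc (1 - p ^+ k.+1).
Proof.
rewrite lerBlDr.
have := le_normcD (1 - p ^+ k.+1) (p ^+ k.+1).
rewrite subrK normc1 normcX => /le_trans; apply; rewrite lerD2l.
by rewrite exprS ler_piMr ?normc_ge0 // exprn_ile1 // ?normc_ge0 // ltW.
Qed.

Lemma qpoch_neq0 k : qpoch p k != 0.
Proof.
rewrite /qpoch; elim: k => [|k IH]; first by rewrite big_geq // oner_neq0.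
rewrite big_nat_recr //= mulf_neq0 //.
by apply/eqP => h; have := normc_1B_ge k; rewrite h normc0 subr_le0 leNgt p_lt1.
Qed.

Lemma cvg_qpoch : exists l : C, converges (qpoch p) l.
Proof.
have [l hl] := cvg_prod_geometric (- p); exists l.
by apply: (converges_ext hl) => N; apply: eq_bigr => j _; rewrite mulrN exprSr.
Qed.

(** Writing 1 / (1 - p^(j+1)) as 1 + p^(j+1) / (1 - p^(j+1)) makes this another product with
    geometrically small terms, by the uniform bound [normc_1B_ge]. *)
Lemma cvg_qpochV : exists l : C, converges (fun k => (qpoch p k)^-1) l.
Proof.
have n0 j : 1 - p ^+ j.+1 != 0.
  by apply/eqP => h; have := normc_1B_ge j; rewrite h normc0 subr_le0 leNgt p_lt1.
have [l hl] : exists l : C,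
    converges (fun N => \prod_(0 <= j < N) (1 + p ^+ j.+1 / (1 - p ^+ j.+1))) l.
  apply: (@cvg_prod1D _ _ ((1 - normc p)^-1) (normc p)) => // n.
  rewrite normcM normcX normcV mulrC; apply: ler_pM; rewrite ?invr_ge0 ?exprn_ge0 ?normc_ge0 //.
    rewrite lef_pV2 ?normc_1B_ge // posrE ?subr_gt0 //.
    by rewrite (lt_le_trans _ (normc_1B_ge _)) // subr_gt0.
  by rewrite exprS ler_piMl ?exprn_ge0 ?normc_ge0 // ltW.
exists l; apply: (converges_ext hl) => N; rewrite /qpoch -prodfV; apply: eq_bigr => j _.
by field.
Qed.

(** The ratio of consecutive terms is P^k W, which is eventually at most 1/2. *)
Lemma superexponential_decay (P W : R) : 0 <= P < 1 -> 0 <= W ->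
  exists D, forall k, P ^+ 'C(k, 2) * W ^+ k <= D * 2^-1 ^+ k.
Proof.
move=> /andP[P0 P1] W0.
pose u k := P ^+ 'C(k, 2) * W ^+ k.
have u0 k : 0 <= u k by rewrite mulr_ge0 ?exprn_ge0.
have [k0 hk0] : exists k0, forall k, (k0 <= k)%N -> P ^+ k * W <= 2^-1.
  have h : (fun k => W * P ^+ k) @ \oo --> (0 : R).
    by apply: (@cvg_geometric R); rewrite ger0_norm.
  have e0 : (0 : R) < 2^-1 by rewrite invr_gt0.
  have /cvgr0Pnorm_lt/(_ _ e0)[k0 _ hk] := h.
  exists k0 => k /hk /=; rewrite mulrC => /ltW; apply: le_trans; exact: ler_norm.
(* This constant dominates each [u j * 2 ^+ j] with j <= k0; beyond [k0] the ratio bound takes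
   over. *)
exists (\sum_(j < k0.+1) u j * 2 ^+ j) => k; rewrite -/(u k).
have small j : (j <= k0)%N -> u j <= (\sum_(j < k0.+1) u j * 2 ^+ j) * 2^-1 ^+ j.
  move=> jk; rewrite exprVn ler_pdivlMr ?exprn_gt0 //.
  rewrite (bigD1 (Ordinal (jk : (j < k0.+1)%N))) //= lerDl.
  by apply: sumr_ge0 => i _; rewrite mulr_ge0 ?exprn_ge0.
elim: k => [|k IH]; first exact: small.
case: (leqP k.+1 k0) => [|k0k]; first exact: small.
have -> : u k.+1 = u k * (P ^+ k * W).
  by rewrite /u binS bin1 exprD exprSr; ring.
rewrite exprSr [leRHS]mulrA; apply: ler_pM => //; last exact: hk0.
by rewrite mulr_ge0 ?exprn_ge0.
Qed.

(** Terms of negative index are handled as terms in [w^-1], at the cost of dropping a power of [p]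
    of modulus at most 1. *)
Lemma theta_term_decay (w : C) : exists D, geometric_decay (theta_term p w) D 2^-1.
Proof.
have [D1 h1] := superexponential_decay hp (normc_ge0 w).
have [D2 h2] := superexponential_decay hp (normc_ge0 w^-1).
have D10 : 0 <= D1 by have := h1 0%N; rewrite !expr0 !mulr1; exact: le_trans.
have D20 : 0 <= D2 by have := h2 0%N; rewrite !expr0 !mulr1; exact: le_trans.
have pow0 k : (0 : R) <= 2^-1 ^+ k by rewrite exprn_ge0 // invr_ge0.
exists (D1 + D2) => k; rewrite mulrDl; split.
  rewrite normcM normcX -exprnP normcX normcN.
  by apply: le_trans (h1 k) _; rewrite lerDl mulr_ge0.
rewrite normcM normcX (_ : normc ((- w) ^ Negz k) = (normc w ^+ k.+1)^-1); last first.
  by rewrite NegzE -exprnN normcV normcX normcN.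
apply: (@le_trans _ _ (D2 * 2^-1 ^+ k)); last by rewrite lerDr mulr_ge0.
apply: (@le_trans _ _ (D2 * 2^-1 ^+ k.+1)); last first.
  by rewrite ler_wpM2l // exprS ler_piMl // invf_le1 // ler1n.
apply: le_trans (h2 _); rewrite normcV exprVn ler_wpM2r ?invr_ge0 ?exprn_ge0 ?normc_ge0 //.
case/andP: hp => p0 p1; rewrite /tri binS exprD.
by rewrite ler_piMr ?exprn_ge0 // exprn_ile1 // ltW.
Qed.

Lemma theta_coefE N m : theta_coef p N m = (absz m <= N)%:R *
  (qpoch p (N + N) * ((qpoch p (absz (N%:Z + m)))^-1 * (qpoch p (absz (N%:Z - m)))^-1)).
Proof.
rewrite /theta_coef; case: leqP => mN; last by rewrite !mul0r.
congr (_ * _).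
have h : (absz (N%:Z + m)%R <= N + N)%N by lia.
rewrite -(gauss_binomial_qpoch p h).
have -> : (N + N - absz (N%:Z + m)%R)%N = absz (N%:Z - m) by lia.
by field; rewrite !qpoch_neq0.
Qed.

(** For fixed [m] all three [qpoch] indices in [theta_coefE] tend to infinity, so the limit does not
    depend on [m]. *)
Lemma converges_theta_coef : exists g : C,
  forall m, converges (fun N => theta_coef p N m) g.
Proof.
have [l hl] := cvg_qpoch; have [l' hl'] := cvg_qpochV.
exists (1 * (l * (l' * l'))) => m.
apply: converges_ext (fun N => esym (theta_coefE N m)).
apply: convergesM; first exact: (@converges_eventually _ (absz m)).
apply: convergesM.
  by apply: (converges_comp (N0 := 0) _ hl) => n N; lia.
apply: convergesM.
  by apply: (converges_comp (s := fun N => absz (N%:Z + m)) (N0 := absz m) _ hl') => n N; lia.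
by apply: (converges_comp (s := fun N => absz (N%:Z - m)) (N0 := absz m) _ hl') => n N; lia.
Qed.

Lemma theta_coef_bounded : exists A : R, forall N m, normc (theta_coef p N m) <= A.
Proof.
have [l /cvg_bounded_normc[A hA]] := cvg_qpoch.
have [l' /cvg_bounded_normc[A' hA']] := cvg_qpochV.
exists (1 * (A * (A' * A'))) => N m; rewrite theta_coefE !normcM.
apply: ler_pM; rewrite ?mulr_ge0 ?normc_ge0 //.
  by case: (_ <= _)%N; rewrite ?normc1 ?normc0.
apply: ler_pM; rewrite ?mulr_ge0 ?normc_ge0 //.
by apply: ler_pM; rewrite ?mulr_ge0 ?normc_ge0.
Qed.

(** Both the product of truncated thetas and [theta_pair] are sums of the same terms over pairs (m,
    n), with different coefficients; a double use of Tannery's theorem shows that the discrepancy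
    vanishes. That [g] is independent of [x] and [y] lets the Pluecker relation pass to the
    limit. *)
Lemma converges_theta_pair : p != 0 -> exists g : C, forall x y : C, x != 0 -> y != 0 ->
  converges (fun N => g * theta_pair p N x y) (theta p (x * y) * theta p (x / y)).
Proof.
move=> p0.
have [g hg] := converges_theta_coef; have [A hA] := theta_coef_bounded.
exists (g * g) => x y x0 y0.
have xy0 : x * y != 0 by rewrite mulf_neq0.
have xVy0 : x / y != 0 by rewrite mulf_neq0 ?invr_eq0.
have [D1 hD1] := theta_term_decay (x * y).
have [D2 hD2] := theta_term_decay (x / y).
pose S N := int_range (N + N).+1.
(* The difference of the two coefficients at (m, n): bounded uniformly, and tending to 0 for each
   fixed pair. *)
pose w N m n := theta_coef p N m * theta_coef p N n -
  g * g * ((m, n) \in parity_pairs N)%:R.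
have half : 0 <= (2^-1 : R) < 1 by rewrite invr_ge0 ler0n invf_lt1 ?ltr1n.
have A0 : 0 <= A by apply: le_trans (hA 0%N 0); rewrite normc_ge0.
have hw N m n : normc (w N m n) <= A * A + normc (g * g).
  apply: le_trans (le_normcD _ _) _; rewrite normcN; apply: lerD.
    by rewrite normcM; apply: ler_pM; rewrite ?normc_ge0.
  by rewrite normcM; case: (_ \in _); rewrite ?normc1 ?mulr1 // normc0 mulr0 normc_ge0.
have cw m n : converges (fun N => w N m n) 0.
  have -> : 0 = g * g + (- (g * g)) * 1 by rewrite mulr1 subrr.
  apply: (converges_ext (u := fun N => theta_coef p N m * theta_coef p N n +
     (- (g * g)) * ((m, n) \in parity_pairs N)%:R)); last by move=> N; rewrite mulNr.
  apply: convergesD; first exact: convergesM.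
  apply: convergesM; first exact: converges_cst.
  apply: (@converges_eventually _ (absz m + absz n).+1) => N.
  exact: mem_parity_pairs.
have step : converges (fun N => \sum_(m <- S N)
    (\sum_(n <- S N) w N m n * theta_term p (x / y) n) * theta_term p (x * y) m) 0.
  apply: (@tannery_int (fun N m => \sum_(n <- S N) w N m n * theta_term p (x / y) n)
    (theta_term p (x * y)) (fun N => (N + N).+1)
    ((A * A + normc (g * g)) * (D2 / (1 - 2^-1)) *+ 2) _ _ half hD1).
    by move=> N m; exact: (sum_geometric_decay_le (N + N).+1 half hD2 (hw N m)).
  by move=> m; apply: (@tannery_int (fun N n => w N m n) _ _ _ _ _ half hD2 (fun N n => hw N m n)).
have := convergesD (convergesM (theta_cvg (x * y)) (theta_cvg (x / y)))
  (convergesM (converges_cst (-1)) step).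
rewrite mulr0 addr0 => h; apply: (converges_ext h) => N.
have NL : (N < (N + N).+1)%N by rewrite ltnS leq_addr.
have -> := theta_trunc_int_range p0 xy0 NL; have -> := theta_trunc_int_range p0 xVy0 NL.
rewrite theta_pairE //.
rewrite (big_uniq_subset _ (parity_pairs_uniq N) _ (@parity_pairs_sub N)); last first.
  by rewrite allpairs_uniq ?int_range_uniq // => -[? ?] [? ?].
rewrite big_allpairs_dep -/(S N) mulr_suml mulN1r -sumrN -big_split mulr_sumr /=.
apply: eq_bigr => m _.
rewrite mulr_suml -sumrN !mulr_sumr -big_split /=.
apply: eq_bigr => n _; rewrite /w; ring.
Qed.

(** The case p = 0 is separate because the finite triple product divides by p^N. Only the factor 1 -
    x from j = 0 survives, as 0^0 = 1. *)
Lemma theta0 (x : C) : p = 0 -> x != 0 -> theta p x = 1 - x.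
Proof.
move=> p0 x0; apply: converges_unique (theta_cvg x) _.
apply: (converges_near (converges_cst (1 - x)) (N0 := 1)) => -[//|N] _.
rewrite /theta_trunc big_nat_recl // p0 expr1 mul0r subr0 mulr1 mul1r big1 ?mulr1 // => j _.
by rewrite !expr0n /= !mul0r subr0 mulr1.
Qed.

(** For p = 0 this is a rational identity; otherwise both sides are limits of g^2 times the two
    sides of [theta_pair_plucker]. *)
Lemma theta_addition (x y u v : C) : x != 0 -> y != 0 -> u != 0 -> v != 0 ->
  theta p (x * v) * theta p (x / v) * (theta p (u * y) * theta p (u / y)) =
  theta p (x * y) * theta p (x / y) * (theta p (u * v) * theta p (u / v)) +
  u / v * (theta p (v * y) * theta p (v / y) * (theta p (x * u) * theta p (x / u))).
Proof.
move=> x0 y0 u0 v0; have [p0|p0] := eqVneq p 0.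
  rewrite !theta0 ?mulf_neq0 ?invr_eq0 //; field.
  by rewrite v0 y0 u0.
have [g hg] := converges_theta_pair p0.
apply: converges_unique (convergesM (hg x v x0 v0) (hg u y u0 y0)) _.
apply: converges_ext (convergesD (convergesM (hg x y x0 y0) (hg u v u0 v0))
  (convergesM (converges_cst (u / v)) (convergesM (hg v y v0 y0) (hg x u x0 u0)))) _ => N.
have factor (F : comNzRingType) (h A B c D E : F) :
    h * A * (h * B) + c * (h * D * (h * E)) = h * h * (A * B + c * (D * E)) by ring.
by rewrite factor -(theta_pair_plucker p N x0 y0 u0 v0) mulrACA.
Qed.

End Theta.
End ThetaLimit.

(** * File placements *)

Section Combinatorics.
Variables (n : nat) (F : comNzRingType).

(** A file placement is encoded by the row of the rook in each column, or [None], so that columns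
    are chosen independently. *)
Definition board_fun (bs : 'I_n -> nat) (f : {ffun 'I_n -> option 'I_n}) :=
  [forall i, if f i is Some r then (r < bs i)%N else true].

Definition placement_of (f : {ffun 'I_n -> option 'I_n}) : {set cell n} :=
  [set c | f c.1 == Some c.2].

Definition fun_of_placement (Q : {set cell n}) : {ffun 'I_n -> option 'I_n} :=
  [ffun i => [pick r | (i, r) \in Q]].

Lemma placement_ofK : cancel placement_of fun_of_placement.
Proof.
move=> f; apply/ffunP => i; rewrite ffunE; case: pickP => [r|h].
  by rewrite inE => /eqP.
by case E: (f i) => [r|] //; have := h r; rewrite inE /= E eqxx.
Qed.

Lemma fun_of_placementK (Q : {set cell n}) :
  [forall c in Q, forall d in Q, (c.1 == d.1) ==> (c == d)] ->
  placement_of (fun_of_placement Q) = Q.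
Proof.
move=> /forall_inP hQ; apply/setP => -[i r]; rewrite inE ffunE /=.
case: pickP => [s sQ|h]; last by rewrite h.
apply/eqP/idP => [[<-]//|rQ].
have /forall_inP/(_ _ rQ)/implyP := hQ _ sQ.
by move=> /(_ (eqxx _))/eqP[->].
Qed.

Lemma card_placement_of f : #|placement_of f| = (\sum_(i < n) (f i != None))%N.
Proof.
rewrite -sum1_card.
rewrite (eq_bigl (fun c : cell n => true && (f c.1 == Some c.2))); last first.
  by move=> c; rewrite inE.
rewrite -(pair_big_dep xpredT (fun i r => f i == Some r) (fun _ _ => 1%N)) /=.
apply: eq_bigr => i _; case E: (f i) => [s|] /=.
  by rewrite (big_pred1 s) // => r /=; rewrite eq_sym; apply/eqP/eqP => [[]|->].
by rewrite big_pred0.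
Qed.

Lemma mem_file_placements (bs : 'I_n -> nat) f k :
  (placement_of f \in file_placements (column_board bs) k) =
  board_fun bs f && ((\sum_(i < n) (f i != None))%N == k).
Proof.
rewrite inE card_placement_of.
have -> : [forall c in placement_of f, forall d in placement_of f,
    (c.1 == d.1) ==> (c == d)].
  apply/forall_inP => -[i r]; rewrite inE => /= /eqP fi.
  apply/forall_inP => -[j s]; rewrite inE => /= /eqP fj.
  by apply/implyP => /eqP ij; move: fj; rewrite -ij fi => -[->].
rewrite andbT; congr (_ && _); apply/fintype.subsetP/forallP.
  move=> h i; case E: (f i) => [r|] //.
  by have := h (i, r); rewrite !inE /= E eqxx => /(_ isT).
move=> h [i r]; rewrite !inE /= => /eqP fi.
by have := h i; rewrite fi.
Qed.

(** In a column with a rook in the 0-based row r, exactly the cells strictly above it survive,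
    whence the lower bound [r.+1]. *)
Lemma prod_uncancelled (bs : 'I_n -> nat) (w : nat -> F)
    (f : {ffun 'I_n -> option 'I_n}) :
  (forall i, (bs i <= n)%N) ->
  \prod_(c in uncancelled (column_board bs) (placement_of f)) w (rownum c) =
  \prod_(i < n) \prod_((if f i is Some r then r.+1 else 0%N) <= j < bs i) w j.+1.
Proof.
move=> bsn.
pose lo i := if f i is Some r then r.+1 else 0%N.
rewrite (eq_bigl (fun c : cell n => true && (lo c.1 <= c.2 < bs c.1)%N)); last first.
  move=> [i r]; rewrite !inE /= /rownum /lo /=.
  have -> : cancelled (placement_of f) (i, r) =
      if f i is Some s then (r < s)%N else false.
    apply/existsP/idP => [[[j s]]|].
      by rewrite inE /= => /andP[/eqP fj /andP[/eqP ji rs]]; rewrite -ji fj.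
    case E: (f i) => [s|] // rs.
    by exists (i, s); rewrite inE /= E !eqxx.
  case: (f i) => [s|]; last by rewrite andbT.
  rewrite (_ : (Some s == Some r) = (s == r :> nat)); last first.
    by apply/eqP/eqP => [[->]|/val_inj->].
  rewrite andbC; case: ltngtP => //= [h|h]; rewrite ?andbT ?andbF //.
rewrite -(pair_big_dep xpredT (fun i (r : 'I_n) => (lo i <= r < bs i)%N)
  (fun _ (r : 'I_n) => w r.+1)) /=.
apply: eq_bigr => i _; rewrite -/(lo i).
rewrite [RHS]big_geq_mkord.
rewrite (big_ord_widen_cond n (fun j => (lo i <= j)%N) (fun j => w j.+1)) //.
Qed.

(** Expanding the product chooses [None] or a rook position in each column; grouping the choices by
    the number k of empty columns produces x^k. *)
Lemma prod_columns (bs : 'I_n -> nat) (w : nat -> F) (x : F) :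
  (forall i, (bs i <= n)%N) ->
  \prod_(i < n) (x * \prod_(0 <= j < bs i) w j.+1 +
     \sum_(0 <= r < bs i) \prod_(r.+1 <= j < bs i) w j.+1) =
  \sum_(k < n.+1) (\sum_(Q in file_placements (column_board bs) (n - k))
     \prod_(c in uncancelled (column_board bs) Q) w (rownum c)) * x ^+ k.
Proof.
move=> bsn.
pose G i (o : option 'I_n) := if o is Some r then
   if (r < bs i)%N then \prod_(r.+1 <= j < bs i) w j.+1 else 0
   else x * \prod_(0 <= j < bs i) w j.+1.
transitivity (\prod_(i < n) \sum_o G i o).
  apply: eq_bigr => i _; rewrite (bigD1 None) //=; congr (_ + _).
  rewrite (reindex_omap Some id) /=; last by case.
  rewrite big_mkord (big_ord_widen _ (fun r => \prod_(r.+1 <= j < bs i) w j.+1) (bsn i)).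
  by rewrite big_mkcond; apply: eq_big => [r|r _] //=; rewrite eqxx.
rewrite bigA_distr_bigA /=.
pose N (f : {ffun 'I_n -> option 'I_n}) := (\sum_(i < n) (f i != None))%N.
have Nn f : (N f <= n)%N.
  by rewrite -[leqRHS]card_ord -sum1_card; apply: leq_sum => i _; case: (f i != None).
(* A choice with a rook outside the board contains a zero factor. *)
rewrite (bigID (board_fun bs)) /= [X in _ + X]big1 ?addr0; last first.
  move=> f; rewrite negb_forall => /existsP[i hi].
  by rewrite (bigD1 i) //=; case: (f i) hi => //= r /negbTE->; rewrite mul0r.
rewrite (partition_big (fun f => inord (n - N f) : 'I_n.+1) xpredT) //=.
apply: eq_bigr => k _; rewrite mulr_suml.
rewrite (reindex_onto placement_of fun_of_placement); last first.
  by move=> Q; rewrite inE => /and3P[_ _ /fun_of_placementK].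
apply: eq_big => [f|f /andP[/forallP hf /eqP hk]].
  rewrite mem_file_placements placement_ofK eqxx andbT; congr (_ && _).
  rewrite -/(N f) -(inj_eq val_inj) /= inordK ?ltnS ?leq_subr //.
  have kn : (k <= n)%N by rewrite -ltnS.
  apply/eqP/eqP => [<-|->]; by rewrite subKn.
rewrite prod_uncancelled //.
have -> : val k = (\sum_(i < n) (f i == None))%N.
  rewrite -hk /= inordK ?ltnS ?leq_subr //.
  apply/eqP; rewrite -(eqn_add2r (N f)) subnK // /N -big_split /=.
  by rewrite (eq_bigr (fun=> 1%N)) ?sum1_card ?card_ord // => i _; case: (f i).
rewrite expr_sum -big_split; apply: eq_bigr => i _ /=.
have := hf i; rewrite /G; case: (f i) => [r|] /= => [->|_].
  by rewrite expr0 mulr1.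
by rewrite expr1 mulrC.
Qed.

End Combinatorics.

(** * Elliptic numbers *)

Section EllipticNumbers.
Variable R : realType.
Local Notation C := R[i].
Local Open Scope complex_scope.

Lemma cexpD (x y : C) : cexp (x + y) = cexp x * cexp y.
Proof.
case: x => a b; case: y => c d; rewrite /cexp /= expRD cosD sinD.
by apply/eqP; rewrite eq_complex /=; apply/andP; split; apply/eqP; ring.
Qed.

Lemma cexp_neq0 (x : C) : cexp x != 0.
Proof.
have c0 : cexp (0 : C) = 1.
  by apply/eqP; rewrite /cexp /= expR0 cos0 sin0 eq_complex /= mulr1 mulr0 !eqxx.
apply/eqP => h; have := cexpD x (- x).
by rewrite subrr c0 h mul0r => /eqP; rewrite oner_eq0.
Qed.

Lemma cpowD1 (l z : C) : cpow l (z + 1) = cpow l z * cexp l.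
Proof. by rewrite /cpow mulrDl mul1r cexpD. Qed.

Lemma cpowB1 (l z : C) : cpow l (z - 1) = cpow l z / cexp l.
Proof.
apply: (mulIf (cexp_neq0 l)).
by rewrite mulfVK ?cexp_neq0 // -cpowD1 subrK.
Qed.

Variables (p l : C).
Hypothesis p_lt1 : normc p < 1.
Local Notation q := (cexp l).
Local Notation th := (theta p).

Lemma ellnumE (A B z : C) : let Y := cpow l z in
  ellnum l p A B z = (th Y * th (A * Y) * th (B * q ^+ 2) * th (A / B)) /
    (th q * th (A * q) * th (B * (Y * q)) * th (A * (Y / q) / B)).
Proof.
rewrite /ellnum /ellnum_den /thetas !big_cons !big_nil !mulr1 cpowD1 cpowB1.
by rewrite !mulrA.
Qed.

(* [theta_addition] at [(Y s, B q / s, s, s / q)], where [s ^ 2 = A]. *)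
Lemma theta_addition_ell (A B Y : C) : A != 0 -> B != 0 -> Y != 0 ->
  th (Y * q) * th (A * Y / q) * (th (B * q) * th (A / (B * q))) =
  th q * th (A / q) * (th (B * q * Y) * th (A * Y / (q * B))) +
  q * (th B * th (A / (q ^+ 2 * B)) * (th Y * th (A * Y))).
Proof.
move=> A0 B0 Y0.
have q0 : q != 0 := cexp_neq0 l.
have [s sA] : exists s : C, s * s = A by exists (sqrtC A); rewrite -expr2 sqrtCK.
have s0 : s != 0 by apply: contraNneq A0 => s0; rewrite -sA s0 mul0r.
have := @theta_addition R p p_lt1 (Y * s) (B * q / s) s (s / q).
rewrite !mulf_neq0 ?invr_eq0 // => /(_ isT isT s0 isT).
rewrite -sA.
have -> : Y * s * (s / q) = s * s * Y / q by ring.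
have -> : Y * s / (s / q) = Y * q by field; rewrite s0 q0.
have -> : s * (B * q / s) = B * q by field.
have -> : s / (B * q / s) = s * s / (B * q) by field; rewrite s0 B0 q0.
have -> : Y * s * (B * q / s) = B * q * Y by field.
have -> : Y * s / (B * q / s) = s * s * Y / (q * B) by field; rewrite s0 B0 q0.
have -> : s * (s / q) = s * s / q by ring.
have -> : s / (s / q) = q by field; rewrite s0 q0.
have -> : s / q * (B * q / s) = B by field; rewrite s0 q0.
have -> : s / q / (B * q / s) = s * s / (q ^+ 2 * B) by field; rewrite s0 B0 q0.
have -> : Y * s * s = s * s * Y by ring.
have -> : Y * s / s = Y by field.
move=> h; rewrite [th (Y * q) * _]mulrC h; ring.
Qed.

(** Divide [theta_addition_ell] by the first product on its right-hand side: that product becomes 1.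
    The coefficient of [ellnum l p A B z] is the weight w_{A,B}(0). *)
Lemma ellnum_step (A B z : C) : A != 0 -> B != 0 ->
  th q != 0 -> th (A * q) != 0 -> th (A / q) != 0 -> th (B * q ^+ 2) != 0 ->
  th (A / B) != 0 -> th (B * (cpow l z * q)) != 0 ->
  th (A * (cpow l z / q) / B) != 0 ->
  ellnum l p (A / q ^+ 2) (B / q) (z + 1) =
  th (A * q) * th B * th (A / (q ^+ 2 * B)) /
    (th (A / q) * th (B * q ^+ 2) * th (A / B)) * q * ellnum l p A B z + 1.
Proof.
move=> A0 B0 h1 h2 h3 h4 h5 h6 h7.
have q0 : q != 0 := cexp_neq0 l.
have Y0 : cpow l z != 0 by exact: cexp_neq0.
rewrite !ellnumE cpowD1; move: Y0 h6 h7; set Y := cpow l z => Y0 h6 h7.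
have -> : A / q ^+ 2 * (Y * q) = A * Y / q by field.
have -> : B / q * q ^+ 2 = B * q by field.
have -> : A / q ^+ 2 / (B / q) = A / (B * q) by field; rewrite B0 q0.
have -> : A / q ^+ 2 * q = A / q by field.
have e1 : B * (Y * q) = B * q * Y by ring.
have -> : B / q * (Y * q * q) = B * q * Y by field.
have e2 : A * (Y / q) / B = A * Y / (q * B) by field; rewrite B0 q0.
have -> : A / q ^+ 2 * (Y * q / q) / (B / q) = A * Y / (q * B) by field; rewrite B0 q0.
rewrite e1 e2 in h6 h7 *.
have := theta_addition_ell A0 B0 Y0.
rewrite [LHS]mulrA => ->; field.
by rewrite h1 h2 h3 h4 h5 h6 h7.
Qed.

(** Induction on [m], with [ellnum_step] at A = a q^(-2m), B = b q^(-m), for which w_{A,B}(0) =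
    w_{a,b}(-m) is the weight of the new top cell. *)
Lemma ellnum_column (a b z : C) (m : nat) : a != 0 -> b != 0 ->
  ellnum_den l p a b z != 0 ->
  (forall j, (j < m)%N -> ellweight_den a b q p (1 - j.+1%:Z) != 0) ->
  ellnum l p (a * q ^ (- (2 * m%:Z))) (b * q ^ (- m%:Z)) (z + m%:R) =
  ellnum l p a b z * \prod_(0 <= j < m) ellweight a b q p (1 - j.+1%:Z) +
  \sum_(0 <= r < m) \prod_(r.+1 <= j < m) ellweight a b q p (1 - j.+1%:Z).
Proof.
move=> a0 b0 zgen; have q0 : q != 0 := cexp_neq0 l.
have qN k : q ^ (- k%:Z) = (q ^+ k)^-1 by rewrite -exprnN.
have qN2 k : q ^ (- (2 * k%:Z)) = (q ^+ k)^-1 ^+ 2.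
  by rewrite -PoszM qN mulnC exprM exprVn.
have cpowDn k : cpow l (z + k%:R) = cpow l z * q ^+ k.
  elim: k => [|k IH]; first by rewrite addr0 mulr1.
  by rewrite -addn1 natrD addrA cpowD1 IH addn1 exprSr mulrA.
have denE k : ellweight_den a b q p (1 - k.+1%:Z) =
    th (a * (q ^+ k)^-1 ^+ 2 / q) * th (b * (q ^+ k)^-1 * q ^+ 2) *
    th (a * (q ^+ k)^-1 / b).
  have -> : 1 - k.+1%:Z = - k%:Z by lia.
  rewrite /ellweight_den /thetas !big_cons big_nil mulr1 mulrN !expfzDr // qN qN2.
  by rewrite !mulrA exprN1.
move: zgen; rewrite /ellnum_den /thetas !big_cons big_nil mulr1 !mulf_eq0 !negb_or.
rewrite cpowD1 cpowB1 => /and4P[gq gaq gbz gabz].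
elim: m => [|m IH] wgen.
  by rewrite !big_geq // mulr0 oppr0 !expr0z !mulr1 !addr0.
have {}IH := IH (fun j jm => wgen j (ltnW jm)).
rewrite [\prod_(0 <= j < m.+1) _]big_nat_recr //= [\sum_(0 <= r < m.+1) _]big_nat_recr //=.
rewrite [\prod_(m.+1 <= j < m.+1) _]big_geq //.
(* The new top cell multiplies the weight of every earlier rook position; a rook placed in it leaves
   an empty product and gives the summand 1. *)
have -> : \sum_(0 <= r < m) \prod_(r.+1 <= j < m.+1) ellweight a b q p (1 - j.+1%:Z) =
    (\sum_(0 <= r < m) \prod_(r.+1 <= j < m) ellweight a b q p (1 - j.+1%:Z)) *
    ellweight a b q p (1 - m.+1%:Z).
  rewrite mulr_suml; apply: eq_big_nat => r /andP[_ rm].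
  by rewrite big_nat_recr.
rewrite addrA mulrA -mulrDl -IH.
have := wgen m (ltnSn m).
rewrite denE !mulf_eq0 !negb_or => /andP[/andP[g1 g2] g3].
have wE : ellweight a b q p (1 - m.+1%:Z) =
    th (a * (q ^+ m)^-1 ^+ 2 * q) * th (b * (q ^+ m)^-1) *
    th (a * (q ^+ m)^-1 ^+ 2 / (q ^+ 2 * (b * (q ^+ m)^-1))) /
    (th (a * (q ^+ m)^-1 ^+ 2 / q) * th (b * (q ^+ m)^-1 * q ^+ 2) *
     th (a * (q ^+ m)^-1 ^+ 2 / (b * (q ^+ m)^-1))) * q.
  have e : a * (q ^+ m)^-1 ^+ 2 / (b * (q ^+ m)^-1) = a * (q ^+ m)^-1 / b.
    by field; rewrite b0 expf_neq0.
  rewrite /ellweight denE e; congr (_ / _ * _).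
  have -> : 1 - m.+1%:Z = - m%:Z by rewrite intS opprD addrA subrr sub0r.
  rewrite /thetas !big_cons big_nil mulr1 mulrN !expfzDr // qN qN2 expr1z.
  rewrite !mulrA -exprnN; congr (_ * _ * theta p _).
  by rewrite -[q ^+ (1 + 1)]/(q ^+ 2); field; rewrite b0 q0 expf_neq0.
(* For m = 0 this factor occurs in [ellnum_den]; for larger [m] it is a denominator factor of the
   weight one row below. *)
have g0 : th (a * (q ^+ m)^-1 ^+ 2 * q) != 0.
  case: m wgen {IH g1 g2 g3 wE} => [|m] wgen; first by rewrite expr0 invr1 expr1n mulr1.
  have := wgen m (ltnW (ltnSn _)).
  rewrite denE !mulf_eq0 !negb_or => /andP[/andP[+ _] _].
  have -> // : a * (q ^+ m.+1)^-1 ^+ 2 * q = a * (q ^+ m)^-1 ^+ 2 / q.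
  by rewrite [q ^+ m.+1]exprS; field; rewrite q0 expf_neq0.
have Q0 : q ^+ m != 0 by rewrite expf_neq0.
rewrite wE [X in _ = X + 1]mulrC.
have -> : a * q ^ (- (2 * m.+1%:Z)) = a * (q ^+ m)^-1 ^+ 2 / q ^+ 2.
  by rewrite qN2 [q ^+ m.+1]exprS; field; rewrite q0 Q0.
have -> : b * q ^ (- m.+1%:Z) = b * (q ^+ m)^-1 / q.
  by rewrite qN [q ^+ m.+1]exprS; field; rewrite q0 Q0.
rewrite [m.+1%:R]mulrSr addrA qN2 qN.
apply: ellnum_step => //.
- by rewrite mulf_neq0 // expf_neq0 // invr_eq0.
- by rewrite mulf_neq0 // invr_eq0.
- have -> // : a * (q ^+ m)^-1 ^+ 2 / (b * (q ^+ m)^-1) = a * (q ^+ m)^-1 / b.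
  by field; rewrite b0.
(* The shifts cancel in B q^(z+m+1) and A q^(z+m-1) / B, so the last two conditions are the ones
   assumed at [z]. *)
- rewrite cpowDn.
  by have -> : b * (q ^+ m)^-1 * (cpow l z * q ^+ m * q) = b * (cpow l z * q) by field.
- rewrite cpowDn.
  have -> // : a * (q ^+ m)^-1 ^+ 2 * (cpow l z * q ^+ m / q) / (b * (q ^+ m)^-1) =
    a * (cpow l z / q) / b by field; rewrite b0 q0.
Qed.

End EllipticNumbers.

Theorem theorem4p5 (R : realType) (n : nat) (bs : 'I_n -> nat)
    (p q l a b z : R[i])
    (* Ferrers board: 0 <= b_1 <= ... <= b_n <= n *)
    (bs_mono : forall i j : 'I_n, (i <= j)%N -> (bs i <= bs j)%N)
    (bs_le : forall i : 'I_n, (bs i <= n)%N)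
    (p_lt1 : `|p| < 1)
    (* l is the logarithm of q defining q^z *)
    (q_exp : q = cexp l)
    (* genericity: every denominator occurring in the identity is nonzero *)
    (a_neq0 : a != 0) (b_neq0 : b != 0)
    (lhs_gen : forall i : 'I_n,
      ellnum_den l p (a * q ^ (- (2 * (bs i)%:Z))) (b * q ^ (- (bs i)%:Z))
        (z + (bs i)%:R) != 0)
    (rhs_gen : ellnum_den l p a b z != 0)
    (weight_gen : forall c : cell n, c \in column_board bs ->
      ellweight_den a b q p (1 - (rownum c)%:Z) != 0) :
  \prod_(i < n)
    ellnum l p (a * q ^ (- (2 * (bs i)%:Z))) (b * q ^ (- (bs i)%:Z))
      (z + (bs i)%:R)
  = \sum_(k < n.+1)
      file_number a b q p (column_board bs) (n - k) * ellnum l p a b z ^+ k.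
Proof.
have {}p_lt1 : normc p < 1 by rewrite -ltcR.
rewrite /file_number.
(* Both sides are now products over columns, and [ellnum_column] with m = [bs i] matches the
   factors. *)
rewrite -(prod_columns (fun j => ellweight a b q p (1 - j%:Z)) _ bs_le).
apply: eq_bigr => i _; rewrite q_exp; apply: ellnum_column => // j jb.
have jn : (j < n)%N := leq_trans jb (bs_le i).
by have := weight_gen (i, Ordinal jn); rewrite inE -q_exp; exact.
Qed.
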